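(* The Rank Minimization problem is solvable in polynomial time.
   Context: An instance is a tuple $(V,E,\mu,S^* )$: $V$ a finite set, $E\subseteq V\times V$ a reflexive symmetric relation (a simple undirected graph $G=(V,E)$), $\mu:2^V\to[0,\infty)$ additive ($\mu(S)=\sum_{s\in S}\mu(\{s\})$) with $\mu(S)=0$ only for $S=\emptyset$, and $S^*\in\mathcal{S}\cup\{\emptyset\}$, where $\mathcal{S}$ is the set of nonempty subsets $S\subseteq V$ inducing a connected subgraph of $G$. A valid partition is a partition $(S_1,\dots,S_c,S^* )$ of $V$ with all $S_i\in\mathcal{S}$. Rank Minimization asks for a valid partition minimizing the rank $1+|\{i:\mu(S_i)>\mu(S^* )\}|$. *)

(* Defs.v *)
From mathcomp Require Import all_boot all_order all_algebra.
From mathcomp Require Import Rstruct.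
From Stdlib Require Rdefinitions.
Notation R := Rdefinitions.R.
Set Implicit Arguments. Unset Strict Implicit. Unset Printing Implicit Defensive.
Import Order.TTheory GRing.Theory Num.Theory.
Local Open Scope ring_scope.

Definition induced n (adj : rel 'I_n) (S : {set 'I_n}) : rel 'I_n :=
  fun x y => [&& x \in S, y \in S & adj x y].

Definition conn_set n (adj : rel 'I_n) (S : {set 'I_n}) : Prop :=
  S != set0 /\ {in S &, forall x y, connect (induced adj S) x y}.

Definition mu n (w : 'I_n -> R) (S : {set 'I_n}) : R := \sum_(i in S) w i.

(* (V,E,mu,S* ) is an instance: E reflexive symmetric, mu(S)=0 only for S
   empty (i.e. positive singleton weights), S* in \mathcal S or empty *)
Definition is_instance n (adj : rel 'I_n) (w : 'I_n -> R) (Sstar : {set 'I_n})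
  : Prop :=
  [/\ forall x, adj x x,
      forall x y, adj x y = adj y x,
      forall x, 0 < w x
    & Sstar = set0 \/ conn_set adj Sstar].

(* (S_1,...,S_c,S* ) is a valid partition of V, where P = {S_1,...,S_c} *)
Definition valid_partition n (adj : rel 'I_n) (Sstar : {set 'I_n})
  (P : {set {set 'I_n}}) : Prop :=
  partition P (~: Sstar) /\ forall S, S \in P -> conn_set adj S.

Definition rank n (w : 'I_n -> R) (Sstar : {set 'I_n})
  (P : {set {set 'I_n}}) : nat :=
  (1 + #|[set S in P | (mu w Sstar < mu w S)%R]|)%N.

(* Model of computation: a unit-cost RAM with natural-number registers *)
(* (constants, +, truncated -, comparison, indirect addressing) and    *)
(* real-valued registers supporting only +, - and comparison (the      *)
(* standard real-RAM treatment of real input weights).                 *)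

Inductive instr :=
| ISet (r c : nat)
| IAdd (r a b : nat)
| ISub (r a b : nat)
| ILoad (r a : nat)
| IStore (a r : nat)
| IJlt (a b t : nat)
| RAdd (r a b : nat)
| RSub (r a b : nat)
| RJlt (a b t : nat)
| IHalt.

Record state := State { pc : nat; nmem : nat -> nat; rmem : nat -> R }.

Definition upd (T : Type) (f : nat -> T) (x : nat) (v : T) : nat -> T :=
  fun y => if y == x then v else f y.

Definition cur (prog : seq instr) (s : state) : instr := nth IHalt prog (pc s).

Definition halted (prog : seq instr) (s : state) : bool :=
  if cur prog s is IHalt then true else false.

Definition step (prog : seq instr) (s : state) : state :=
  let N := nmem s in let M := rmem s in let p := pc s in
  match cur prog s with
  | ISet r c => State p.+1 (upd N r c) M
  | IAdd r a b => State p.+1 (upd N r (N a + N b)%N) M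
  | ISub r a b => State p.+1 (upd N r (N a - N b)%N) M
  | ILoad r a => State p.+1 (upd N r (N (N a))) M
  | IStore a r => State p.+1 (upd N (N a) (N r)) M
  | IJlt a b t => State (if (N a < N b)%N then t else p.+1) N M
  | RAdd r a b => State p.+1 N (upd M (N r) (M (N a) + M (N b)))
  | RSub r a b => State p.+1 N (upd M (N r) (M (N a) - M (N b)))
  | RJlt a b t => State (if M (N a) < M (N b) then t else p.+1) N M
  | IHalt => s
  end.

Fixpoint exec (prog : seq instr) (fuel : nat) (s : state) : option state :=
  if halted prog s then Some s else
  match fuel with
  | 0 => None
  | f.+1 => exec prog f (step prog s)
  end.

(* Input encoding: N[0] = n; N[1 + i*n + j] = [ij \in E]; N[1 + n*n + i] =
   [i \in S* ]; M[i] = mu({i}); everything else 0; pc starts at 0. *)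
Definition ofnat n (i : nat) : option 'I_n := insub i.

Definition init_state n (adj : rel 'I_n) (w : 'I_n -> R) (Sstar : {set 'I_n})
  : state :=
  State 0
    (fun a =>
       if a == 0 then n
       else if (a <= n * n)%N then
         (if ofnat n ((a - 1) %/ n) is Some i then
          if ofnat n ((a - 1) %% n) is Some j then nat_of_bool (adj i j) else 0
          else 0)%N
       else if (a <= n * n + n)%N then
         (if ofnat n (a - 1 - n * n) is Some i then nat_of_bool (i \in Sstar)
          else 0)%N
       else 0%N)
    (fun a => if ofnat n a is Some i then w i else 0).

(* Output encoding: on halting, vertex i outside S* is put in the part
   labelled N[i]; the output partition is the one induced by the labels. *)
Definition output_partition n (Sstar : {set 'I_n}) (s : state)
  : {set {set 'I_n}} :=
  preim_partition (fun i : 'I_n => nmem s i) (~: Sstar).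

(* Main.v *)
(* Merging all parts inside a connected component of V \ S* leaves at most one
   part heavier than S* there, while any part containing a vertex heavier than S*
   is itself heavier.  So the minimum rank is one plus the number of components
   containing a vertex heavier than S*, and it is attained by keeping these
   components whole and cutting the others into singletons.

   The program computes component labels by relabelling along every edge.  Its
   fixed registers overlap the input and the output, so it first packs the bits
   in registers 1..16 into one number, copies the whole input to fresh
   memory, and writes registers 0..16 of the output last. *)

Require Import Defs.
From mathcomp Require Import all_boot all_order all_algebra.
From mathcomp Require Import Rstruct zify.
From Stdlib Require Rdefinitions.
Set Implicit Arguments. Unset Strict Implicit. Unset Printing Implicit Defensive.

(** * Structured programs on the RAM *)

#[local] Notation nmemT := (nat -> nat).
#[local] Notation rmemT := (nat -> R).

Lemma upd_same (T : Type) (f : nat -> T) x v y : y = x -> upd f x v y = v.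
Proof. by move=> ->; rewrite /upd eqxx. Qed.

Lemma upd_diff (T : Type) (f : nat -> T) x v y : y <> x -> upd f x v y = f y.
Proof. by rewrite /upd; case: eqP. Qed.

(** An upper bound on the time, rather than an exact time, lets the two branches of a test share one
    cost. *)
Definition reaches prog (t : nat) (Q : state -> Prop) (s : state) : Prop :=
  exists2 t', t' <= t & Q (iter t' (step prog) s).

Lemma reaches_now prog t (Q : state -> Prop) s : Q s -> reaches prog t Q s.
Proof. by exists 0. Qed.

Lemma reaches_step prog t Q s :
  reaches prog t Q (step prog s) -> reaches prog t.+1 Q s.
Proof. by case=> t' le_t' Qt'; exists t'.+1; rewrite // iterSr. Qed.

Lemma reaches_bind prog t1 t2 Q s :
  reaches prog t1 (reaches prog t2 Q) s -> reaches prog (t1 + t2) Q s.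
Proof.
case=> t le_t [u le_u Qu]; exists (u + t); first by rewrite addnC leq_add.
by rewrite iterD.
Qed.

Lemma reaches_weaken prog t1 t2 (Q1 Q2 : state -> Prop) s :
  t1 <= t2 -> (forall s', Q1 s' -> Q2 s') ->
  reaches prog t1 Q1 s -> reaches prog t2 Q2 s.
Proof. by move=> le_t Q12 [t le_t1 /Q12]; exists t => //; apply: leq_trans le_t. Qed.

Lemma halted_step prog s : halted prog s -> step prog s = s.
Proof. by rewrite /halted /step; case: (cur prog s). Qed.

(** A halted state is a fixed point of [step], so a run that halts early is already in the later
    iterate, and surplus fuel is harmless. *)
Lemma exec_reaches prog t fuel Q s :
  reaches prog t (fun s' => halted prog s' /\ Q s') s -> t <= fuel ->
  exists s', exec prog fuel s = Some s' /\ Q s'.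
Proof.
case=> t' le_t' [halt_t' Qt'] le_t; have {le_t' le_t} := leq_trans le_t' le_t.
elim: t' fuel s halt_t' Qt' => [|t' IHt] fuel s.
  by move=> /= hs Qs _; exists s; split=> //; case: fuel => [|fuel] /=; rewrite hs.
rewrite iterSr => ht Qt; case: fuel => // fuel le_t /=.
case: ifP => [hs | _]; last exact: IHt.
exists s; split=> //; move: Qt.
by rewrite halted_step // iter_fix // halted_step.
Qed.

(** * Structured commands, their code and their cost *)

Inductive cmd :=
| Skip
| Ins of instr
| Seq of cmd & cmd
| Unless of nat & nat & cmd
| RUnless of nat & nat & cmd
| For of nat & nat & cmd.

(* Register permanently holding the constant 1, used by [For]. *)
Notation ONE := 2.

Fixpoint csize (c : cmd) : nat :=
  match c with
  | Skip => 0
  | Ins _ => 1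
  | Seq c1 c2 => csize c1 + csize c2
  | Unless _ _ c | RUnless _ _ c => (csize c).+1
  | For _ _ c => (csize c).+4
  end.

(** Jump targets are absolute, hence the start address [p]. The jump of [Unless] passes over its
    body, which therefore runs exactly when the comparison fails. A loop tests for an empty range at
    entry and afterwards only at its bottom. *)
Fixpoint compile (p : nat) (c : cmd) : seq instr :=
  match c with
  | Skip => [::]
  | Ins i => [:: i]
  | Seq c1 c2 => compile p c1 ++ compile (p + csize c1) c2
  | Unless a b c => IJlt a b (p + (csize c).+1) :: compile p.+1 c
  | RUnless a b c => RJlt a b (p + (csize c).+1) :: compile p.+1 c
  | For i m c =>
      [:: ISet i 0, IJlt m ONE (p + (csize c).+4) & compile p.+2 c]
        ++ [:: IAdd i i ONE; IJlt i m p.+2]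
  end.

(** Here [b] bounds the number of rounds of every loop. A round adds an increment and a jump to the
    body, and the entry takes two instructions. *)
Fixpoint cost (b : nat) (c : cmd) : nat :=
  match c with
  | Skip => 0
  | Ins _ => 1
  | Seq c1 c2 => cost b c1 + cost b c2
  | Unless _ _ c | RUnless _ _ c => (cost b c).+1
  | For _ _ c => b * (cost b c + 2) + 2
  end.

Lemma size_compile p c : size (compile p c) = csize c.
Proof.
elim: c p => //= [c1 IH1 c2 IH2 | a b c IHc | a b c IHc | i m c IHc] p.
- by rewrite size_cat IH1 IH2.
- by rewrite IHc.
- by rewrite IHc.
- by rewrite size_cat IHc addn2.
Qed.

(** Exponents add in a sequence and grow by one in a loop. *)
Lemma cost_poly c : exists C k, forall b, 0 < b -> cost b c <= C * b ^ k.
Proof.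
elim: c => [| i | c1 [C1 [k1 IH1]] c2 [C2 [k2 IH2]] | x y c [C [k IH]]
  | x y c [C [k IH]] | x y c [C [k IH]]] /=.
- by exists 0, 0.
- by exists 1, 0.
- exists (C1 + C2), (k1 + k2) => b b0; rewrite mulnDl leq_add //.
    by apply: leq_trans (IH1 b b0) _; rewrite leq_mul2l leq_pexp2l ?leq_addr ?orbT.
  by apply: leq_trans (IH2 b b0) _; rewrite leq_mul2l leq_pexp2l ?leq_addl ?orbT.
- exists C.+1, k => b b0; rewrite mulSn addnC -addn1 leq_add ?IH ?expn_gt0 ?b0 //.
- exists C.+1, k => b b0; rewrite mulSn addnC -addn1 leq_add ?IH ?expn_gt0 ?b0 //.
- exists (C + 4), k.+1 => b b0; have := IH b b0.
  have : 0 < b ^ k by rewrite expn_gt0 b0.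
  rewrite expnS; move: (cost b c) (b ^ k) => u v v0 le_u.
  have : b * (u + 2) <= b * (C * v + 2) by rewrite leq_mul2l leq_add2r le_u orbT.
  nia.
Qed.

(** * Timed total correctness of commands *)

Definition placed (prog : seq instr) (p : nat) (code : seq instr) : Prop :=
  exists2 pre, size pre = p & exists post, prog = pre ++ code ++ post.

Lemma placed_cat prog p c1 c2 :
  placed prog p (c1 ++ c2) -> placed prog p c1 /\ placed prog (p + size c1) c2.
Proof.
case=> pre pre_p [post ->]; rewrite -!catA; split; first by exists pre => //; exists (c2 ++ post).
by exists (pre ++ c1); [rewrite size_cat pre_p | exists post; rewrite -!catA].
Qed.

Lemma placed_cons prog p i c :
  placed prog p (i :: c) -> nth IHalt prog p = i /\ placed prog p.+1 c.
Proof.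
move=> /(@placed_cat _ _ [:: i]) [[pre <- [post ->]]] /=; rewrite addn1 => pl.
by split=> //; rewrite nth_cat ltnn subnn.
Qed.

(** A weakest precondition with termination and running time built in. Quantifying over the
    surrounding program and the address makes the rules below compose. *)
Definition ok (b : nat) (c : cmd) (Q : nmemT -> rmemT -> Prop)
    (N : nmemT) (M : rmemT) : Prop :=
  forall prog p, placed prog p (compile p c) ->
  reaches prog (cost b c)
    (fun s => pc s = p + csize c /\ Q (nmem s) (rmem s)) (State p N M).

Lemma ok_Skip b (Q : nmemT -> rmemT -> Prop) N M : Q N M -> ok b Skip Q N M.
Proof. by move=> QNM prog p _; apply: reaches_now; rewrite addn0. Qed.

Lemma ok_Seq b c1 c2 Q N M :
  ok b c1 (ok b c2 Q) N M -> ok b (Seq c1 c2) Q N M.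
Proof.
move=> ok12 prog p /= /placed_cat [/ok12 r1]; rewrite size_compile => pl2.
apply: reaches_bind; apply: reaches_weaken r1 => // -[p' N' M'] /= [->].
by move=> /(_ _ _ pl2); rewrite addnA.
Qed.

Section Instructions.
Context (b : nat) (Q : nmemT -> rmemT -> Prop) (N : nmemT) (M : rmemT).

Lemma ok_Ins i :
  (forall prog p, nth IHalt prog p = i -> exists N' M',
     step prog (State p N M) = State p.+1 N' M' /\ Q N' M') ->
  ok b (Ins i) Q N M.
Proof.
move=> H prog p /placed_cons [/H [N' [M' [step_p QNM]]] _].
apply: (@reaches_step _ 0); apply: reaches_now.
by rewrite step_p /= addn1.
Qed.

Ltac one_instr :=
  intros; apply: ok_Ins => ? ?; rewrite /step /cur /= => ->;
  do 2 eexists; split; [reflexivity | auto].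

(** Naming the written value by an equation on [v] allows it to be simplified before it enters the
    memory term; the next rules on natural registers share this form. *)
Lemma ok_ISet r c : (forall v, v = c -> Q (upd N r v) M) -> ok b (Ins (ISet r c)) Q N M.
Proof. one_instr. Qed.

Lemma ok_IAdd r x y :
  (forall v, v = N x + N y -> Q (upd N r v) M) -> ok b (Ins (IAdd r x y)) Q N M.
Proof. one_instr. Qed.

Lemma ok_ISub r x y :
  (forall v, v = N x - N y -> Q (upd N r v) M) -> ok b (Ins (ISub r x y)) Q N M.
Proof. one_instr. Qed.

Lemma ok_ILoad r x :
  (forall v, v = N (N x) -> Q (upd N r v) M) -> ok b (Ins (ILoad r x)) Q N M.
Proof. one_instr. Qed.

Lemma ok_IStore x r :
  (forall v a, a = N x -> v = N r -> Q (upd N a v) M) ->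
  ok b (Ins (IStore x r)) Q N M.
Proof. one_instr. Qed.

Lemma ok_RAdd r x y :
  Q N (upd M (N r) (M (N x) + M (N y))%R) -> ok b (Ins (RAdd r x y)) Q N M.
Proof. one_instr. Qed.

Lemma ok_Unless x y c :
  (N y <= N x -> ok b c Q N M) -> (N x < N y -> Q N M) ->
  ok b (Unless x y c) Q N M.
Proof.
move=> ok_c Qskip prog p /= /placed_cons [nth_p pl]; apply: reaches_step.
rewrite /step /cur /= nth_p; case: ltnP => [lt_xy | le_yx].
  by apply: reaches_now => /=; split=> //; apply: Qskip.
apply: reaches_weaken (ok_c le_yx _ _ pl) => // s [-> Qs].
by rewrite addSn addnS.
Qed.

Lemma ok_RUnless x y c :
  (~~ (M (N x) < M (N y))%R -> ok b c Q N M) -> ((M (N x) < M (N y))%R -> Q N M) ->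
  ok b (RUnless x y c) Q N M.
Proof.
move=> ok_c Qskip prog p /= /placed_cons [nth_p pl]; apply: reaches_step.
rewrite /step /cur /= nth_p; case: ifPn => [lt_xy | le_yx].
  by apply: reaches_now => /=; split=> //; apply: Qskip.
apply: reaches_weaken (ok_c le_yx _ _ pl) => // s [-> Qs].
by rewrite addSn addnS.
Qed.

End Instructions.

(** [I k] is the invariant at the start of round [k], with the counter already set. The proof is by
    induction on the number [m - k] of remaining rounds; the counter, the bound and the constant 1
    must survive the body because the closing test reads them. *)
Lemma ok_For b i r c (I : nat -> nmemT -> rmemT -> Prop) m Q N M :
  m <= b -> N r = m -> N ONE = 1 -> r <> i -> ONE <> i ->
  (forall v, v = 0 -> I 0 (upd N i v) M) ->
  (forall k N M, k < m -> N i = k -> N r = m -> N ONE = 1 -> I k N M ->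
     ok b c (fun N' M' => [/\ N' i = k, N' r = m, N' ONE = 1
                            & forall v, v = k.+1 -> I k.+1 (upd N' i v) M']) N M) ->
  (forall N M, I m N M -> N r = m -> N ONE = 1 -> Q N M) ->
  ok b (For i r c) Q N M.
Proof.
move=> le_mb Nr N1 ri onei I0 IS Qend prog p /=.
case/placed_cons=> nth_p /placed_cons[nth_p1 /placed_cat[pl_c]].
rewrite size_compile => /placed_cons[nth_i /placed_cons[nth_j _]].
rewrite addn2; do 2 apply: reaches_step.
rewrite /step /cur /= nth_p /= nth_p1 /= !upd_diff // Nr N1.
case: ltnP => [m0 | m0].
  apply: reaches_now => /=; split=> //; apply: Qend; rewrite ?upd_diff //.
  have -> : m = 0 by lia.
  exact: I0.
suff loop k N' M' : k < m -> N' i = k -> N' r = m -> N' ONE = 1 -> I k N' M' ->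
    reaches prog ((m - k) * (cost b c + 2))
      (fun s => pc s = p + (csize c).+4 /\ Q (nmem s) (rmem s)) (State p.+2 N' M').
  have i0 : upd N i 0 i = 0 by rewrite upd_same.
  have r0 : upd N i 0 r = m by rewrite upd_diff.
  have one0 : upd N i 0 ONE = 1 by rewrite upd_diff // => /esym/onei.
  apply: (reaches_weaken _ _ (loop 0 _ _ m0 i0 r0 one0 (I0 0 erefl))) => //.
  by rewrite subn0 leq_mul2r le_mb orbT.
have [d] := ubnP (m - k); elim: d k N' M' => // d IHd k N' M' le_d lt_km Ni Nr' N1' Ik.
have -> : (m - k) * (cost b c + 2) =
    cost b c + ((m - k.+1) * (cost b c + 2)).+2 by nia.
apply: reaches_bind; apply: reaches_weaken (IS _ _ _ lt_km Ni Nr' N1' Ik _ _ pl_c) => //.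
case=> _ N2 M2 /= [-> [N2i N2r N21 IkS]]; do 2 apply: reaches_step.
rewrite /step /cur /= nth_i /= nth_j /= N2i N21 addn1 upd_same // upd_diff // N2r.
case: ltnP => [lt_k1m | le_mk1].
  by apply: IHd => //; [lia | rewrite upd_same | rewrite upd_diff
    | rewrite upd_diff // => /esym/onei | exact: IkS].
apply: reaches_now; split=> /=; first by lia.
have mE : m = k.+1 by lia.
apply: Qend; rewrite ?upd_diff //.
by rewrite [X in I X]mE; apply: IkS.
Qed.

Lemma ok_exec b c (Q : nmemT -> rmemT -> Prop) N M fuel :
  ok b c Q N M -> cost b c <= fuel ->
  exists s, exec (compile 0 c) fuel (State 0 N M) = Some s /\ Q (nmem s) (rmem s).
Proof.
move=> ok_c; apply: exec_reaches.
have pl : placed (compile 0 c) 0 (compile 0 c).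
  by exists [::] => //; exists [::]; rewrite cats0.
apply: reaches_weaken (ok_c _ _ pl) => // s [pc_s Qs]; split=> //.
(* The program counter is just past the code, where [cur] yields the default [IHalt]. *)
by rewrite /halted /cur pc_s add0n nth_default // size_compile.
Qed.

(** * Optimal partitions *)

Section Optimality.
Context (n : nat) (adj : rel 'I_n) (w : 'I_n -> R) (Sstar : {set 'I_n}).
Hypothesis inst : is_instance adj w Sstar.

Let e := induced adj (~: Sstar).

Definition heavy (x : 'I_n) : bool := (mu w Sstar < w x)%R.

(** Outside [Sstar], the second disjunct keeps components with a heavy vertex whole; the first alone
    remains on the others and cuts them into singletons. *)
Definition same_part (x y : 'I_n) : bool :=
  (x == y) || connect e x y && [exists h, heavy h && connect e x h].

Lemma induced_sym A x y : induced adj A x y = induced adj A y x.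
Proof. by case: inst => _ sym_adj _ _; rewrite /induced sym_adj andbCA. Qed.

Lemma connect_induced_sym A : connect_sym (induced adj A).
Proof. apply: sym_connect_sym => x y; exact: induced_sym. Qed.

Lemma connect_mem (A : {set 'I_n}) x y : x \in A -> connect (induced adj A) x y -> y \in A.
Proof.
move=> xA /connectP[p]; elim: p x xA => [|z p IHp] x xA /=; first by move=> _ ->.
by case/andP=> /and3P[_ zA _]; apply: IHp.
Qed.

Lemma le_mu (A : {set 'I_n}) x : x \in A -> (w x <= mu w A)%R.
Proof.
case: inst => _ _ w_gt0 _ xA; rewrite /mu (bigD1 x) //= Num.Theory.lerDl.
by apply: Num.Theory.sumr_ge0 => i _; apply: Order.POrderTheory.ltW.
Qed.

(** Only the level sets of [f] outside [Sstar] matter; in the end [f] is the final memory. *)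
Context (f : 'I_n -> nat).
Hypothesis fE : {in ~: Sstar &, forall x y, (f x == f y) = same_part x y}.

Let P := preim_partition f (~: Sstar).

Lemma partP : partition P (~: Sstar).
Proof. exact: preim_partitionP. Qed.

Lemma part_mem S x y : S \in P -> x \in S -> (y \in S) = (y \in ~: Sstar) && same_part x y.
Proof.
move=> SP xS; have /and3P[/eqP covP trivP _] := partP.
have xD : x \in ~: Sstar by rewrite -covP; apply/bigcupP; exists S.
have xyD : y \in S -> y \in ~: Sstar by move=> yS; rewrite -covP; apply/bigcupP; exists S.
case yD: (y \in ~: Sstar); last by apply/negP => /xyD; rewrite yD.
rewrite -(def_pblock trivP SP xS) pblock_equivalence_partition //= ?fE //.
by move=> a b c _ _ _ /=; split=> // /eqP ->.
Qed.

Lemma valid_parts : valid_partition adj Sstar P.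
Proof.
split; first exact: partP.
move=> S SP; have /and3P[/eqP covP trivP P0] := partP.
split; first by apply: contraNneq P0 => <-.
move=> x y xS yS; have := yS; rewrite (part_mem _ SP xS) => /andP[_].
case/orP=> [/eqP-> // | /andP[xy hx]].
case/connectP: xy => p; elim: p x xS hx => [|z p IHp] x xS hx /=; first by move=> _ ->.
case/andP=> xz path_p y_last.
(* A neighbour of [x] lies in the same component, which has a heavy vertex, so the path never leaves
   [S]. *)
have zS : z \in S.
  rewrite (part_mem _ SP xS) /same_part connect1 // hx orbT andbT.
  by case/and3P: xz.
apply: (@connect_trans _ _ z).
  by apply: connect1; rewrite /induced xS zS; case/and3P: xz.
apply: IHp => //; have /existsP[h /andP[hh xh]] := hx.
apply/existsP; exists h; rewrite hh; apply: connect_trans xh.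
by apply: connect1; rewrite /e induced_sym.
Qed.

(** Two distinct elements of a part lie in a component with a heavy vertex, and that vertex then
    belongs to the part. So a part without heavy vertices is a singleton, no heavier than its one
    light vertex. *)
Lemma heavy_part S : S \in P -> (mu w Sstar < mu w S)%R ->
  exists2 h, h \in S & heavy h.
Proof.
move=> SP muS; have [/exists_inP // | /exists_inPn light] := boolP [exists h in S, heavy h].
have [/set0Pn[x xS] _] := valid_parts.2 S SP.
have S1 : S = [set x].
  apply/setP=> y; rewrite inE (part_mem _ SP xS); apply/andP/eqP => [[_] | ->].
    case/orP=> [/eqP // | /andP[_ /existsP[h /andP[hh xh]]]].
    have /light/negP[] // : h \in S.
    rewrite (part_mem _ SP xS) /same_part xh orbC /=.
    rewrite (connect_mem _ xh) /=; first by apply/orP; left; apply/existsP; exists h; rewrite hh.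
    by have:= xS; rewrite (part_mem _ SP xS) => /andP[].
  by apply/andP; rewrite -(part_mem _ SP xS).
have := light x xS; rewrite /heavy; have <- : mu w S = w x by rewrite /mu S1 big_set1.
by rewrite muS.
Qed.

(** Send each part of [P] heavier than [Sstar] to the block of [Q] around one of its heavy vertices.
    That block is heavier than [Sstar] too. Blocks of [Q] are connected outside [Sstar], so two
    heavy vertices in one block share a component and hence a part of [P]: the map is injective. *)
Lemma rank_le Q : valid_partition adj Sstar Q -> rank w Sstar P <= rank w Sstar Q.
Proof.
case=> partQ connQ; have /and3P[/eqP covQ trivQ Q0] := partQ.
rewrite /rank leq_add2l.
(* By [heavy_part], the default [set0] does not occur on [HP]. *)
pose g (S : {set 'I_n}) := if [pick x in S | heavy x] is Some x then pblock Q x else set0.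
pose HP := [set S in P | (mu w Sstar < mu w S)%R].
have gP S : S \in HP ->
    exists x, [/\ S \in P, x \in S, x \in ~: Sstar, heavy x & g S = pblock Q x].
  rewrite inE => /andP[SP muS]; rewrite /g; case: pickP => [x /andP[xS hx] | none].
    exists x; split=> //; have /and3P[/eqP <- _ _] := partP.
    by apply/bigcupP; exists S.
  by have [x xS hx] := heavy_part SP muS; have := none x; rewrite xS hx.
have inj_g : {in HP &, injective g}.
  move=> S T /gP[x [SP xS xD hx ->]] /gP[y [TP yT yD hy ->]] eq_xy.
  have xQ : x \in pblock Q x by rewrite mem_pblock covQ.
  have yQ : y \in pblock Q x by rewrite eq_xy mem_pblock covQ.
  have BQ : pblock Q x \in Q by rewrite pblock_mem ?covQ.
  have xy : connect e x y.
    have [_ /(_ x y xQ yQ)] := connQ _ BQ.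
    apply: connect_sub => a b /and3P[aB bB ab]; apply: connect1.
    by apply/and3P; split=> //; rewrite -covQ; apply/bigcupP; exists (pblock Q x).
  have yS : y \in S.
    rewrite (part_mem _ SP xS) yD /same_part xy orbC /=.
    by apply/orP; left; apply/existsP; exists y; rewrite hy.
  have /and3P[_ trivP _] := partP.
  by rewrite -(def_pblock trivP SP yS) (def_pblock trivP TP yT).
rewrite -(card_in_imset inj_g); apply/subset_leq_card/subsetP => _ /imsetP[S SH ->].
have [x [SP xS xD hx ->]] := gP S SH.
rewrite inE pblock_mem ?covQ //=; apply: Order.POrderTheory.lt_le_trans hx (le_mu _).
by rewrite mem_pblock covQ.
Qed.

End Optimality.

(** * The program *)

Declare Scope cmd_scope.
Delimit Scope cmd_scope with cmd.
Bind Scope cmd_scope with cmd.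
#[local] Infix ";;" := Seq (at level 61, right associativity) : cmd_scope.
#[local] Coercion Ins : instr >-> cmd.

(* Registers: 0 holds n, 2 and 3 the constants 1 and 0, and 4, 5, 6, 7 the
   addresses B = n^2 + n + 17 (the copy of input cell a is B + a), S (membership
   in S* ), L (component labels) and O (output labels); 8..16 are temporary. *)

(* Leaves in register 1 the number with binary digits N[1], ..., N[j + 1]. *)
Fixpoint pack (j : nat) : cmd :=
  if j is j'.+1 then pack j' ;; IAdd 1 1 1 ;; IAdd 1 1 j'.+2 else Skip.

(** There is no multiplication, so register 16 collects n^2 by repeated addition; it then becomes
    n^2 + n and finally the number n^2 + n + 1 of cells to copy. *)
Definition setup : cmd :=
  ISet 2 1 ;; ISet 3 0 ;; ISet 16 0 ;; For 8 0 (IAdd 16 16 0) ;;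
  IAdd 5 16 2 ;; IAdd 16 16 0 ;; ISet 4 17 ;; IAdd 4 16 4 ;; IAdd 5 4 5 ;;
  IAdd 16 16 2 ;; IAdd 6 4 16 ;; IAdd 7 6 0 ;;
  For 8 16 (IAdd 11 4 8 ;; ILoad 12 8 ;; IStore 11 12).

(** Digits are read from the most significant one: digit [j] is 1 when register 1 is at least 2^(16
    - j), which is then subtracted. Register 11 walks through the copy. *)
Fixpoint unpack (j : nat) : cmd :=
  if j is j'.+1 then
    unpack j' ;; IAdd 11 11 2 ;; ISet 13 (2 ^ (16 - j)) ;; ISet 12 0 ;;
    Unless 1 13 (ISet 12 1 ;; ISub 1 1 13) ;; IStore 11 12
  else Skip.

(* The accumulator is the real register n, the first one initially 0. *)
Definition sum_weights : cmd :=
  For 8 0 (IAdd 11 5 8 ;; ILoad 12 11 ;; Unless 12 2 (RAdd 0 0 8)).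

Definition init_labels : cmd :=
  For 8 0 (IAdd 11 6 8 ;; IStore 11 8 ;; IAdd 11 7 8 ;; IStore 11 8).

(** The test always reads the component labels; [d] selects the array written, 6 for these labels
    themselves and 7 for the output. Two nested [Unless] test equality with the old label in
    register 14. *)
Definition relabel (d : nat) : cmd :=
  For 10 0 (IAdd 11 6 10 ;; ILoad 12 11 ;;
    Unless 12 14 (Unless 14 12 (IAdd 11 d 10 ;; IStore 11 13))).

(** Register 15 walks through the adjacency matrix row by row, which avoids computing products. The
    matrix starts at B + 1, so the increment precedes the read. *)
Definition merge_labels : cmd :=
  IAdd 15 4 3 ;;
  For 8 0 (For 9 0 (
    IAdd 15 15 2 ;; ILoad 12 15 ;; Unless 12 2 (
    IAdd 11 5 8 ;; ILoad 12 11 ;; Unless 3 12 (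
    IAdd 11 5 9 ;; ILoad 12 11 ;; Unless 3 12 (
    IAdd 11 6 8 ;; ILoad 13 11 ;; IAdd 11 6 9 ;; ILoad 14 11 ;; relabel 6))))).

(** Real operands are addressed through natural registers: [RUnless 0 8] compares the accumulator,
    real register n, with the weight of the vertex in register 8. *)
Definition mark_heavy : cmd :=
  For 8 0 (ISet 12 1 ;; RUnless 0 8 (ISet 12 0) ;;
    Unless 12 2 (IAdd 11 6 8 ;; ILoad 13 11 ;; IAdd 14 13 3 ;; relabel 7)).

Fixpoint fill (r : nat) : cmd :=
  if r is r'.+1 then fill r' ;; ILoad r' 16 ;; IAdd 16 16 15 else Skip.

(** Entries from 17 on are copied while the working registers are still needed, then registers 0..14
    are filled. Registers 16 and 15 end up holding O + 16 and O + 15, and each loads through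
    itself. *)
Definition write_output : cmd :=
  ISet 13 17 ;;
  For 8 0 (IAdd 11 7 8 ;; ILoad 12 11 ;; Unless 8 13 (IStore 8 12)) ;;
  ISet 15 1 ;; IAdd 16 7 3 ;; fill 15 ;;
  IAdd 16 16 15 ;; ISub 15 16 15 ;; ILoad 16 16 ;; ILoad 15 15.

Definition rank_min : cmd :=
  pack 15 ;; setup ;; IAdd 11 4 3 ;; unpack 16 ;; sum_weights ;; init_labels ;;
  merge_labels ;; mark_heavy ;; write_output.

(** * Tactics for symbolic execution *)

Ltac simp_upd_in H :=
  repeat match type of H with context [upd ?f ?x ?v ?y] =>
    first [ rewrite (@upd_same _ f x v y erefl) in H
          | let E := fresh in
            assert (E : y <> x) by (first [done | lia]);
            rewrite (@upd_diff _ f x v y E) in H; clear E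
          | let E := fresh in
            assert (E : y = x) by lia; rewrite (@upd_same _ f x v y E) in H; clear E ] end.

Ltac simp_upd :=
  repeat match goal with |- context [upd ?f ?x ?v ?y] =>
    first [ rewrite (@upd_same _ f x v y erefl)
          | let E := fresh in
            assert (E : y <> x) by (first [done | lia]);
            rewrite (@upd_diff _ f x v y E); clear E
          | let E := fresh in
            assert (E : y = x) by lia; rewrite (@upd_same _ f x v y E); clear E ] end.

Ltac known_in H :=
  repeat match type of H with context [?f ?r] =>
    is_var f; match goal with E : f r = _ |- _ =>
      lazymatch E with H => fail | _ => rewrite E in H end end end.

Ltac known :=
  repeat match goal with |- context [?f ?r] =>
    is_var f; match goal with E : f r = _ |- _ => rewrite E end end.

Ltac value := let v := fresh "v" in let hv := fresh "hv" in
  intros v hv; simp_upd_in hv; known_in hv; subst v.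

Ltac instr1 := first
  [ apply: ok_ISet; value | apply: ok_IAdd; value | apply: ok_ISub; value
  | apply: ok_ILoad; value
  | apply: ok_IStore; let v := fresh "v" in let a := fresh "a" in
    let hv := fresh "hv" in let ha := fresh "ha" in
    intros v a ha hv; simp_upd_in hv; known_in hv; subst v;
    simp_upd_in ha; known_in ha; subst a ].

Ltac ins := first [apply: ok_Seq; instr1 | instr1].

Ltac fin :=
  lazymatch goal with
  | |- _ /\ _ => split; fin
  | |- and3 _ _ _ => split; fin
  | |- and4 _ _ _ _ => split; fin
  | |- and5 _ _ _ _ _ => split; fin
  | |- forall v, v = _ -> _ =>
      let v := fresh "v" in let hv := fresh "hv" in intros v hv; subst v; fin
  | |- forall _, _ => intro; fin
  | _ => simp_upd; known; try first [done | lia]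
  end.

(** * Correctness of the program *)

Section Correctness.
Context (n : nat) (N0 : nmemT) (b : nat).
Hypothesis N0_0 : N0 0 = n.
Hypothesis N0_bit : forall a, 0 < a -> N0 a <= 1.
Hypothesis le_b : n * n + n + 1 <= b.
Context (q B S L O : nat).
Hypothesis hq : q = n * n + n.
Hypothesis hB : B = q + 17.
Hypothesis hS : S = B + (n * n + 1).
Hypothesis hL : L = B + (q + 1).
Hypothesis hO : O = L + n.

(** * Saving the input in fresh memory *)

Fixpoint prefix_val (j : nat) : nat :=
  if j is j'.+1 then prefix_val j' + prefix_val j' + N0 j else 0.

(** The [d] digits that follow contribute less than 2^d; this is what makes the greedy reading in
    [unpack] correct. *)
Lemma prefix_val_bounds d j :
  2 ^ d * prefix_val j <= prefix_val (j + d) < 2 ^ d * (prefix_val j).+1.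
Proof.
elim: d => [|d IHd]; first by rewrite addn0; lia.
have := N0_bit (ltn0Sn (j + d)).
rewrite addnS /= expnS => bit; move: bit IHd.
move: (N0 _) (prefix_val (j + d)) (prefix_val j) (2 ^ d) => x y z t hx /andP[h1 h2].
by apply/andP; split; nia.
Qed.

Lemma pack_ok j M (Q : nmemT -> rmemT -> Prop) :
  (forall N, (forall a, a <> 1 -> N a = N0 a) -> N 1 = prefix_val j.+1 -> Q N M) ->
  ok b (pack j) Q N0 M.
Proof.
elim: j Q => [|j IHj] Q HQ /=; first by apply: ok_Skip; apply: HQ.
apply: ok_Seq; apply: IHj => N Na N1.
do 2 ins; apply: HQ => [a a1 | ]; simp_upd; first exact: Na.
by rewrite Na /=; lia.
Qed.

Definition regs (N : nmemT) : Prop :=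
  (N 0 = n /\ N 2 = 1 /\ N 3 = 0) /\ (N 4 = B /\ N 5 = S /\ N 6 = L /\ N 7 = O).

Lemma regs_upd N a v : 8 <= a -> regs N -> regs (upd N a v).
Proof. by move=> a8 [[? [? ?]] [? [? [? ?]]]]; do !split; simp_upd. Qed.

Lemma setup_ok N M (Q : nmemT -> rmemT -> Prop) :
  (forall a, a <> 1 -> N a = N0 a) ->
  (forall N', regs N' -> N' 1 = N 1 ->
     (forall a, 17 <= a <= q -> N' (B + a) = N0 a) -> Q N' M) ->
  ok b setup Q N M.
Proof.
move=> Na HQ; have N_0 : N 0 = n by rewrite Na.
do 3 ins.
pose I1 k N' (M' : rmemT) :=
  [/\ N' 0 = n, N' 2 = 1, N' 3 = 0, N' 16 = k * n & N' 1 = N 1 /\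
     (forall a, 17 <= a -> N' a = N0 a) /\ M' = M].
apply: ok_Seq; apply: (@ok_For _ _ _ _ I1 n) => //; first by lia.
- rewrite /I1; fin; apply: Na; lia.
- move=> k N1 M1 lt_k N1i N1r N11 [R0 R2 R3 R16 [N1_1 [Na1 ->]]].
  ins; rewrite /I1; fin; exact: Na1.
move=> {}N1 M1 [R0 R2 R3 R16 [N1_1 [Na1 ->]]] _ _.
do 8 ins.
(* Targets lie above [q], so no unread source is overwritten. Cells up to 16 may already be spoilt,
   hence the restriction to addresses from 17 on; [unpack] repairs the copies of 1..16. This is the
   longest loop, and its [q + 1] rounds account for [le_b]. *)
pose I2 k N' (M' : rmemT) :=
  [/\ regs N', N' 16 = q + 1 , N' 1 = N 1, M' = M &
     (forall a, 17 <= a <= q -> N' a = N0 a) /\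
     (forall a, 17 <= a <= q -> a < k -> N' (B + a) = N0 a)].
apply: (@ok_For _ _ _ _ I2 (q + 1)) => //; first by lia.
- by fin.
- rewrite /I2 /regs; fin; apply: Na1; lia.
- move=> k N2 M2 lt_k N2i N2r N21 [r2 R16' N2_1 -> [Na2 Nc]]; have := r2 => -[[? [? ?]] [? [? [? ?]]]].
  do 3 ins; rewrite /I2; fin; [by do ?apply: regs_upd => //; lia | exact: Na2 |].
  have [<- | ne] := eqVneq k a; simp_upd; first by apply: Na2; lia.
  by apply: Nc; lia.
move=> N2 M2 [r2 R16' N2_1 -> [Na2 Nc]] _ _.
apply: HQ => // a ha; apply: Nc => //; lia.
Qed.

(** After [j] digits, register 1 holds the value of the last 16 - j digits; by the bounds on
    prefixes, comparing it with the next power of two reveals the next digit. *)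
Lemma unpack_ok j N M (Q : nmemT -> rmemT -> Prop) :
  j <= 16 -> regs N -> N 1 = prefix_val 16 -> N 11 = B ->
  (forall a, 17 <= a <= q -> N (B + a) = N0 a) ->
  (forall N', regs N' -> N' 1 + 2 ^ (16 - j) * prefix_val j = prefix_val 16 ->
     N' 11 = B + j -> (forall a, 0 < a <= j -> N' (B + a) = N0 a) ->
     (forall a, 17 <= a <= q -> N' (B + a) = N0 a) -> Q N' M) ->
  ok b (unpack j) Q N M.
Proof.
have bounds k : k <= 16 ->
    2 ^ (16 - k) * prefix_val k <= prefix_val 16 < 2 ^ (16 - k) * (prefix_val k).+1.
  by move=> lek; have := prefix_val_bounds (16 - k) k; rewrite subnKC.
(* [prefix_val 16] must stay abstract: unfolding it is exponential. *)
move: (prefix_val 16) bounds => V bounds.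
move=> + rN N1 N11 Nhi; elim: j Q => [|j IHj] Q lej HQ.
  apply: ok_Skip; apply: HQ => //; last by move=> a; lia.
    by rewrite [prefix_val 0]/= muln0 addn0.
  by rewrite addn0.
rewrite /=; apply: ok_Seq; apply: IHj => [|N' r' N'1 N'11 N'lo N'hi]; first by lia.
have := bounds _ lej; rewrite [prefix_val j.+1]/=; have := N0_bit (ltn0Sn j).
have e2 : 2 ^ (16 - j) = 2 ^ (16 - j.+1) + 2 ^ (16 - j.+1).
  by rewrite (_ : 16 - j = (16 - j.+1).+1); [rewrite expnS mul2n -addnn | lia].
move: HQ N'1; rewrite /= e2 => {e2}.
move: (2 ^ (16 - j.+1)) (prefix_val j) => t P HQ N'1 bit /andP[lo hi].
have [[R0 [R2 R3]] [R4 [R5 [R6 R7]]]] := r'.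
do 3 ins.
apply: ok_Seq; apply: ok_Unless; simp_upd => le_t.
  do 3 ins; have x1 : N0 j.+1 = 1 by nia.
  apply: HQ; rewrite ?x1 /regs; fin.
    have [-> | ne] := eqVneq a j.+1; simp_upd; first by rewrite x1.
    by apply: N'lo; lia.
  exact: N'hi.
ins; have x0 : N0 j.+1 = 0 by nia.
apply: HQ; rewrite ?x0 /regs; fin.
  have [-> | ne] := eqVneq a j.+1; simp_upd; first by rewrite x0.
  by apply: N'lo; lia.
exact: N'hi.
Qed.

(** The copy ends just below [L], so the phases between loading and output can write temporaries and
    labels without damaging it. *)
Definition inv (N : nmemT) : Prop :=
  regs N /\ forall a, 0 < a <= q -> N (B + a) = N0 a.

Lemma inv_upd N a v : 8 <= a <= 16 \/ L <= a -> inv N -> inv (upd N a v).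
Proof.
move=> ha [rN hN]; split; first by apply: regs_upd => //; lia.
by move=> a' ha'; simp_upd; apply: hN.
Qed.

Lemma load_ok M (Q : nmemT -> rmemT -> Prop) c :
  (forall N, inv N -> ok b c Q N M) ->
  ok b (pack 15 ;; setup ;; IAdd 11 4 3 ;; unpack 16 ;; c) Q N0 M.
Proof.
move=> HQ; apply: ok_Seq; apply: pack_ok => N Na N1.
apply: ok_Seq; apply: setup_ok => // N' rN' N'1 N'hi.
have [[R0 [R2 R3]] [R4 [R5 [R6 R7]]]] := rN'.
ins; apply: ok_Seq; apply: unpack_ok => //.
- by simp_upd; rewrite N'1.
- by simp_upd; lia.
- by move=> a ha; simp_upd; apply: N'hi.
move=> N2 r2 _ _ lo hi; apply: HQ; split=> // a ha.
by case: (leqP a 16) => ?; [apply: lo | apply: hi]; lia.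
Qed.

Lemma inv_sbit N i : inv N -> i < n -> N (S + i) = N0 (n * n + 1 + i).
Proof. by move=> [_ hN] lt_i; rewrite hS -addnA hN //; lia. Qed.

Lemma inv_adj N i j : inv N -> i < n -> j < n -> N (B + i * n + j + 1) = N0 (i * n + j + 1).
Proof. by move=> [_ hN] lt_i lt_j; rewrite -!addnA hN //; nia. Qed.

Definition acc (M0 : rmemT) (k : nat) : R :=
  (\sum_(i <- iota 0 k | (0 < N0 (n * n + 1 + i))%N) M0 i)%R.

Lemma sum_weights_ok N M (Q : nmemT -> rmemT -> Prop) :
  inv N -> M n = 0%R ->
  (forall N' M', inv N' -> M' n = acc M n -> (forall i, i < n -> M' i = M i) ->
     Q N' M') ->
  ok b sum_weights Q N M.
Proof.
move=> iN Mn HQ; have [[[R0 [R2 R3]] _] _] := iN.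
pose I (k : nat) N' (M' : rmemT) :=
  [/\ inv N', M' n = acc M k & forall i, i < n -> M' i = M i].
apply: (@ok_For _ _ _ _ I n) => //; first by lia.
- move=> v _; split=> //; first by apply: inv_upd => //; lia.
  by rewrite /acc big_nil.
- move=> k {}N {iN Mn R0 R2 R3} M1 lt_k N8 R0 R2 [iN M1n M1i].
  have [[[_ [_ R3]] [R4 [R5 [R6 R7]]]] _] := iN.
  do 2 ins; rewrite (inv_sbit iN lt_k).
  have accS : acc M k.+1 = (acc M k + (if (0 < N0 (n * n + 1 + k))%N then M k else 0))%R.
    by rewrite /acc -addn1 iotaD big_cat /= big_cons big_nil; case: ifP; rewrite ?GRing.addr0.
  apply: ok_Unless; simp_upd; known => hk.
    apply: ok_RAdd; simp_upd; known; split; fin.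
    split; first by do ?apply: inv_upd => //; lia.
      by rewrite upd_same // ?M1n M1i // accS hk.
    by move=> i lt_i; rewrite upd_diff ?M1i //; lia.
  split; fin; split; [by do ?apply: inv_upd => //; lia | | by []].
  by rewrite ?M1n accS ltnNge -ltnS hk GRing.addr0.
by move=> N' M' [iN' M'n M'i] _ _; apply: HQ.
Qed.

Lemma init_labels_ok N M (Q : nmemT -> rmemT -> Prop) :
  inv N ->
  (forall N', inv N' -> (forall k, k < n -> N' (L + k) = k /\ N' (O + k) = k) ->
     Q N' M) ->
  ok b init_labels Q N M.
Proof.
move=> iN HQ; have [[[R0 [R2 R3]] _] _] := iN.
pose I (k : nat) N' (M' : rmemT) :=
  [/\ inv N', M' = M & forall i, i < k -> N' (L + i) = i /\ N' (O + i) = i].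
apply: (@ok_For _ _ _ _ I n) => //; first by lia.
- by move=> v _; split=> //; apply: inv_upd => //; lia.
- move=> k {}N {iN R0 R2 R3} M1 lt_k N8 R0 R2 [iN -> hk].
  have [[[_ [_ R3]] [R4 [R5 [R6 R7]]]] _] := iN.
  do 4 ins; fin; split=> //; first by do ?apply: inv_upd => //; lia.
  move=> i lt_i; have [-> | ne] := eqVneq i k; first by simp_upd.
  by simp_upd; apply: hk; lia.
by move=> N' M' [iN' -> hN'] _ _; apply: HQ.
Qed.

Lemma relabel_ok d D N M x y (Q : nmemT -> rmemT -> Prop) :
  inv N -> d = 6 /\ D = L \/ d = 7 /\ D = O -> N 13 = x -> N 14 = y ->
  (forall N', inv N' -> N' 8 = N 8 -> N' 9 = N 9 -> N' 15 = N 15 ->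
     (forall a, L <= a -> N' a =
        if (D <= a < D + n) && (N (L + (a - D)) == y) then x else N a) -> Q N' M) ->
  ok b (relabel d) Q N M.
Proof.
move=> iN hd N13 N14 HQ; have [[[R0 [R2 R3]] _] _] := iN.
pose I (k : nat) N' (M' : rmemT) :=
  [/\ inv N', N' 8 = N 8 /\ N' 9 = N 9, N' 15 = N 15 /\ N' 13 = x, N' 14 = y /\ M' = M
    & forall a, L <= a -> N' a =
        if (D <= a < D + k) && (N (L + (a - D)) == y) then x else N a].
apply: (@ok_For _ _ _ _ I n) => //; first by lia.
- move=> v _; split; [by apply: inv_upd => //; lia | by fin | by fin | by fin |].
  by move=> a ha; simp_upd; case: ifP => //; lia.
- move=> k N' {R0 R2 R3} M1 lt_k N10 R0 R2 [iN' [R8 R9] [R15 R13] [R14 ->] hk].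
  have [[[_ [_ R3]] [R4 [R5 [R6 R7]]]] _] := iN'.
  have Nd : N' d = D by case: hd => -[-> ->].
  do 2 ins.
  (* Earlier rounds changed only entries of index below [k] of one array, so the label read here is
     still the original one, even when the labels themselves are being rewritten. *)
  have -> : N' (L + k) = N (L + k).
    by rewrite hk ?leq_addr //; case: ifP => //; lia.
  apply: ok_Unless; simp_upd; known => h1; last first.
    fin; split; [by do ?apply: inv_upd => //; lia | by fin | by fin | by fin |].
    move=> a ha; simp_upd; rewrite hk //.
    have [aE | ne] := eqVneq a (D + k); last by congr (if _ then _ else _); lia.
    by rewrite aE addKn; do 2 (case: ifP => //); lia.
  apply: ok_Unless; simp_upd; known => h2; last first.
    fin; split; [by do ?apply: inv_upd => //; lia | by fin | by fin | by fin |].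
    move=> a ha; simp_upd; rewrite hk //.
    have [aE | ne] := eqVneq a (D + k); last by congr (if _ then _ else _); lia.
    by rewrite aE addKn; do 2 (case: ifP => //); lia.
  do 2 ins; fin; split; [by do ?apply: inv_upd => //; lia | by fin | by fin | by fin |].
  move=> a ha; have [aE | ne] := eqVneq a (D + k).
    by rewrite aE; simp_upd; rewrite addKn; case: ifP => //; lia.
  by simp_upd; rewrite hk //; congr (if _ then _ else _); lia.
move=> N' M' [iN' [R8 R9] [R15 R13] [R14 ->] hk] _ _; exact: HQ.
Qed.

(** * Component labels *)

Definition edge (i j : nat) : bool :=
  [&& 0 < N0 (i * n + j + 1), N0 (n * n + 1 + i) == 0 & N0 (n * n + 1 + j) == 0].

(** Any equivalence containing the edges suffices here; it is instantiated with [conn_nat]. *)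
Context (conn : nat -> nat -> Prop).
Hypothesis conn_refl : forall i, i < n -> conn i i.
Hypothesis conn_sym : forall i j, conn i j -> conn j i.
Hypothesis conn_trans : forall i j k, conn i j -> conn j k -> conn i k.
Hypothesis conn_edge : forall i j, i < n -> j < n -> edge i j -> conn i j.

(** A label has to be a vertex of the component it names: this later keeps it apart from the indices
    that label singletons elsewhere. *)
Definition labelling (lab : nat -> nat) : Prop :=
  forall k, k < n -> lab k < n /\ conn k (lab k).

(** The pairs lexicographically before (i, j) are those already scanned. *)
Definition merged (lab : nat -> nat) (i j : nat) : Prop :=
  forall x y, x < n -> y < n -> x < i \/ x = i /\ y < j -> edge x y -> lab x = lab y.

(** The new label is a function of the old one, so equalities already obtained persist and a single
    pass over the edges suffices. A relabelled [k] stays connected to its label through [lab j], [j]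
    and [i]. *)
Lemma labelling_merge lab lab' i j :
  labelling lab -> merged lab i j -> i < n -> j < n -> edge i j ->
  (forall k, k < n -> lab' k = if lab k == lab j then lab i else lab k) ->
  labelling lab' /\ merged lab' i j.+1.
Proof.
move=> lab_ok mrg lt_i lt_j e_ij lab'E; split=> [k lt_k | x y lt_x lt_y hxy e_xy].
  rewrite lab'E //; case: eqP => [kj | _]; last exact: lab_ok.
  have [lt_li ci] := lab_ok i lt_i; have [_ cj] := lab_ok j lt_j.
  have [_ ck] := lab_ok k lt_k.
  split=> //; apply: conn_trans ck _; rewrite kj.
  apply: conn_trans (conn_sym cj) (conn_trans _ ci).
  exact/conn_sym/conn_edge.
rewrite !lab'E //; have [xy_ij | ne] := boolP ((x == i) && (y == j)).
  by case/andP: xy_ij => /eqP -> /eqP ->; rewrite eqxx; case: ifP.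
by rewrite (mrg x y) //; lia.
Qed.

Lemma merge_labels_ok N M (Q : nmemT -> rmemT -> Prop) :
  inv N -> (forall k, k < n -> N (L + k) = k /\ N (O + k) = k) ->
  (forall N', inv N' -> labelling (fun k => N' (L + k)) ->
     (forall x y, x < n -> y < n -> edge x y -> N' (L + x) = N' (L + y)) ->
     (forall k, k < n -> N' (O + k) = k) -> Q N' M) ->
  ok b merge_labels Q N M.
Proof.
move=> iN N_init HQ; have [[[R0 [R2 R3]] [R4 [R5 [R6 R7]]]] _] := iN; ins.
pose J i j N' (M' : rmemT) :=
  [/\ inv N' /\ M' = M, N' 15 = B + i * n + j, labelling (fun k => N' (L + k)),
      merged (fun k => N' (L + k)) i j & forall k, k < n -> N' (O + k) = k].
have J_upd i j N' M' a v : 8 <= a <= 16 -> a <> 15 -> J i j N' M' -> J i j (upd N' a v) M'.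
  move=> ha a15 [[iN' M'E] R15 lN mN oN]; split; fin; first by apply: inv_upd => //; lia.
  - by move=> k lt_k; simp_upd; apply: lN.
  - by move=> x y lt_x lt_y; simp_upd; apply: mN.
  - exact: oN.
apply: (@ok_For _ _ _ _ (fun i => J i 0) n) => //; first by lia.
- move=> v _; apply: J_upd => //; split; fin; first by apply: inv_upd => //; lia.
  + by move=> k lt_k; simp_upd; rewrite (N_init k lt_k).1; split=> //; apply: conn_refl.
  + by move=> x y _ _; lia.
  + exact: (N_init _ _).2.
- move=> i N1 M1 {R0 R2 R3 R4 R5 R6 R7} lt_i N1_8 _ _ J1.
  have [[[[[R0 [R2 R3]] _] _] _] _ _ _ _] := J1.
  apply: (@ok_For _ _ _ _ (fun j N' M' => N' 8 = i /\ J i j N' M') n) => //; first by lia.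
  + by move=> v _; split; fin; apply: J_upd.
  + move=> j N2 M2 {R0 R2 R3} lt_j N2_9 _ _ [N2_8 J2].
    have [[iN2 M2E] N2_15 lN mN oN] := J2.
    have [[[R0 [R2 R3]] [R4 [R5 [R6 R7]]]] _] := iN2.
    have next N3 : N3 8 = i -> J i j.+1 N3 M2 ->
        forall v, v = j.+1 -> upd N3 9 v 8 = i /\ J i j.+1 (upd N3 9 v) M2.
      by move=> *; split; [simp_upd | apply: J_upd].
    have skip N3 : ~~ edge i j -> inv N3 -> N3 15 = B + i * n + j + 1 ->
        (forall a, L <= a -> N3 a = N2 a) -> J i j.+1 N3 M2.
      move=> ne iN3 N3_15 hN3; split=> //; first by lia.
      * by move=> k lt_k; rewrite hN3 ?leq_addr //; apply: lN.
      * move=> x y lt_x lt_y hxy e_xy; rewrite !hN3 ?leq_addr //; apply: mN => //.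
        have [xi | ] := eqVneq x i; last by lia.
        have [yj | ] := eqVneq y j; last by lia.
        by move: ne; rewrite -xi -yj e_xy.
      * by move=> k lt_k; rewrite hN3 ?oN //; lia.
    do 2 ins; rewrite (inv_adj iN2 lt_i lt_j).
    apply: ok_Unless; simp_upd; known => e1; last first.
      split=> //; apply: next; first by fin.
      by apply: skip; fin; [rewrite /edge; lia | do ?apply: inv_upd => //; lia].
    do 2 ins; rewrite (inv_sbit iN2 lt_i).
    apply: ok_Unless; simp_upd; known => e2; last first.
      split=> //; apply: next; first by fin.
      by apply: skip; fin; [rewrite /edge; lia | do ?apply: inv_upd => //; lia].
    do 2 ins; rewrite (inv_sbit iN2 lt_j).
    apply: ok_Unless; simp_upd; known => e3; last first.
      split=> //; apply: next; first by fin.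
      by apply: skip; fin; [rewrite /edge; lia | do ?apply: inv_upd => //; lia].
    do 4 ins; apply: (@relabel_ok 6 L _ _ (N2 (L + i)) (N2 (L + j))).
    - by do ?apply: inv_upd => //; lia.
    - by left.
    - by simp_upd.
    - by simp_upd.
    move=> N3 iN3 N3_8 N3_9 N3_15 hN3.
    simp_upd_in N3_8; simp_upd_in N3_9; simp_upd_in N3_15.
    have [[[R0' [R2' _]] _] _] := iN3.
    have [] // := @labelling_merge (fun k => N2 (L + k)) (fun k => N3 (L + k)) i j lN mN lt_i lt_j.
    - by rewrite /edge; lia.
    - move=> k lt_k; rewrite hN3 ?leq_addr // addKn; simp_upd.
      by rewrite ?leq_addr ltn_add2l lt_k.
    move=> lN3 mN3; split; try lia; apply: next; first by lia.
    split=> //; first by lia.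
    move=> k lt_k; rewrite hN3; last by lia.
    by rewrite (_ : O + k < L + n = false) ?andbF /=; [simp_upd; apply: oN | lia].
  (* At the end of a row, [J i n] turns into [J i.+1 0]. *)
  + move=> N2 M2 [N2_8 J2] N2_0 N2_2; split=> // v _; apply: J_upd => //.
    have [? N2_15 ? mN ?] := J2; split=> //; first by lia.
    by move=> x y lt_x lt_y hxy; apply: mN => //; lia.
move=> N1 M1 [[iN1 ->] _ lN mN oN] _ _; apply: HQ => // x y lt_x lt_y.
by apply: mN => //; left.
Qed.

(** Counting in [i] the vertices tested so far lets one formula serve as loop invariant and, at
    [i = n], as result. *)
Definition out_label (lab : nat -> nat) (heavy : pred nat) (i k : nat) : nat :=
  if has (fun h => heavy h && (lab h == lab k)) (iota 0 i) then lab k else k.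

Lemma mark_heavy_ok N M (Q : nmemT -> rmemT -> Prop) :
  inv N -> (forall k, k < n -> N (O + k) = k) ->
  (forall N', inv N' -> (forall k, k < n -> N' (O + k) =
       out_label (fun i => N (L + i)) (fun h => (M n < M h)%R) n k) -> Q N' M) ->
  ok b mark_heavy Q N M.
Proof.
move=> iN oN HQ; have [[[R0 [R2 R3]] _] _] := iN.
pose lab i := N (L + i); pose hv h := (M n < M h)%R.
pose I (i : nat) N' (M' : rmemT) := [/\ inv N', M' = M, forall k, k < n -> N' (L + k) = lab k
  & forall k, k < n -> N' (O + k) = out_label lab hv i k].
apply: (@ok_For _ _ _ _ I n) => //; first by lia.
- move=> v _; split=> //; first by apply: inv_upd => //; lia.
  + by move=> k lt_k; simp_upd.
  + by move=> k lt_k; simp_upd; rewrite oN.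
- move=> i N1 M1 {R0 R2 R3} lt_i R8 R0 R2 [iN1 -> lN1 oN1].
  have [[[_ [_ R3]] [R4 [R5 [R6 R7]]]] _] := iN1.
  have out_labelS k : out_label lab hv i.+1 k =
      if hv i && (lab i == lab k) then lab i else out_label lab hv i k.
    rewrite /out_label -addn1 iotaD has_cat /= add0n orbF.
    by case: (has _ _) => /=; case: (boolP (hv i && _)) => // /andP[_ /eqP ->].
  have light N3 : ~~ hv i -> inv N3 -> (forall a, L <= a -> N3 a = N1 a) ->
      forall v, v = i.+1 -> I i.+1 (upd N3 8 v) M.
    move=> lt_w iN3 hN3 v _; split=> //; first by apply: inv_upd => //; lia.
      by move=> k lt_k; simp_upd; rewrite hN3 ?leq_addr // lN1.
    by move=> k lt_k; simp_upd; rewrite hN3 ?oN1 // ?out_labelS ?(negPf lt_w) //; lia.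
  ins; apply: ok_Seq; apply: ok_RUnless; simp_upd; known => hi.
    ins; apply: ok_Unless; simp_upd; known => // _; split=> //.
    by apply: light; fin; do ?apply: inv_upd => //; lia.
  apply: ok_Unless; simp_upd; known => // _.
  do 3 ins; apply: (@relabel_ok 7 O _ _ (lab i) (lab i)).
  + by do ?apply: inv_upd => //; lia.
  + by right.
  + by simp_upd; rewrite lN1.
  + by simp_upd; rewrite lN1 // addn0.
  move=> N3 iN3 N3_8 _ _ hN3; simp_upd_in N3_8.
  have [[[R0' [R2' _]] _] _] := iN3; split; try lia.
  move=> v _; split=> //; first by apply: inv_upd => //; lia.
    move=> k lt_k; simp_upd; rewrite hN3 ?leq_addr //.
    by rewrite (_ : O <= L + k = false) /=; [simp_upd; apply: lN1 | lia].
  move=> k lt_k; simp_upd; rewrite hN3; last by lia.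
  rewrite leq_addr ltn_add2l lt_k addKn /=; simp_upd; rewrite lN1 // oN1 //.
  by rewrite out_labelS /hv hi [lab k == _]eq_sym.
by move=> N' M' [iN' -> _ oN'] _ _; apply: HQ.
Qed.

(** The bound on [r] keeps the increment in register 15 and the pointer in register 16 out of the
    filled range. *)
Lemma fill_ok r N M (Q : nmemT -> rmemT -> Prop) :
  r <= 15 -> N 15 = 1 -> N 16 = O ->
  (forall N', N' 15 = 1 -> N' 16 = O + r -> (forall a, a < r -> N' a = N (O + a)) ->
     (forall a, 17 <= a -> N' a = N a) -> Q N' M) ->
  ok b (fill r) Q N M.
Proof.
move=> + N15 N16; elim: r Q => [|r IHr] Q ler HQ.
  by apply: ok_Skip; apply: HQ => //; rewrite addn0.
rewrite /=; apply: ok_Seq; apply: IHr => [|N' N'15 N'16 lo hi]; first by lia.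
do 2 ins; apply: HQ; fin.
  have [-> | ne] := eqVneq a r; simp_upd; first by apply: hi; lia.
  by apply: lo; lia.
exact: hi.
Qed.

Lemma write_output_ok N M (Q : nmemT -> rmemT -> Prop) :
  inv N ->
  (forall N', (forall k, k < n -> N' k = N (O + k)) -> Q N' M) ->
  ok b write_output Q N M.
Proof.
move=> iN HQ; have [[[R0 [R2 R3]] [R4 [R5 [R6 R7]]]] _] := iN; ins.
pose I (i : nat) N' (M' : rmemT) := [/\ N' 3 = 0 /\ N' 7 = O, N' 13 = 17, M' = M,
  forall k, O <= k -> N' k = N k & forall k, 17 <= k < i -> N' k = N (O + k)].
apply: ok_Seq; apply: (@ok_For _ _ _ _ I n) => //; first by lia.
- by move=> v _; split; fin; lia.
- move=> i N1 M1 {R0 R2 R3 R4 R5 R6 R7} lt_i R8 R0 R2 [[R3 R7] R13 -> hi lo].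
  do 2 ins; rewrite hi ?leq_addr //; apply: ok_Unless; simp_upd; known => i17.
    ins; fin; split; fin; first exact: hi.
    have [-> | ne] := eqVneq k i; simp_upd => //.
    by apply: lo; lia.
  fin; split; fin; exact: hi.
move=> N1 M1 {R0 R2 R3 R4 R5 R6 R7} [[R3 R7] R13 -> hi lo] _ _.
do 2 ins; apply: ok_Seq; apply: fill_ok => //; first by simp_upd; rewrite addn0.
move=> N2 N2_15 N2_16 lo2 hi2; do 4 ins; apply: HQ => k lt_k.
have [-> | ne16] := eqVneq k 16.
  simp_upd; rewrite hi2; last by lia.
  by simp_upd; rewrite hi -?addnA // leq_addr.
have [-> | ne15] := eqVneq k 15.
  simp_upd; rewrite hi2; last by lia.
  by simp_upd; rewrite hi; [congr N; lia | lia].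
simp_upd; case: (ltnP k 15) => k15.
  by rewrite lo2 //; simp_upd; rewrite hi ?leq_addr.
by rewrite hi2; [simp_upd; apply: lo; lia | lia].
Qed.

Lemma rank_min_ok M :
  M n = 0%R ->
  ok b rank_min (fun N' _ => exists lab, [/\ labelling lab,
      forall x y, x < n -> y < n -> edge x y -> lab x = lab y
    & forall k, k < n -> N' k = out_label lab (fun h => (acc M n < M h)%R) n k]) N0 M.
Proof.
move=> Mn; apply: load_ok => N1 iN1; apply: ok_Seq; apply: sum_weights_ok => //.
move=> N2 M2 iN2 M2n M2i; apply: ok_Seq; apply: init_labels_ok => // N3 iN3 hN3.
apply: ok_Seq; apply: merge_labels_ok => // N4 iN4 labN4 mN4 oN4.
apply: ok_Seq; apply: mark_heavy_ok => // N5 iN5 oN5.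
apply: write_output_ok => // N6 oN6; exists (fun k => N4 (L + k)); split=> // k lt_k.
rewrite oN6 // oN5 // /out_label; congr (if _ then _ else _).
by apply: eq_in_has => h; rewrite mem_iota /= add0n => lt_h; rewrite M2n M2i.
Qed.

End Correctness.

(** * From the encoded instance back to the graph *)

Section InitialState.
Context (n : nat) (adj : rel 'I_n) (w : 'I_n -> R) (Sstar : {set 'I_n}).

Let N0 := nmem (init_state adj w Sstar).
Let M0 := rmem (init_state adj w Sstar).

Lemma init_bit a : 0 < a -> N0 a <= 1.
Proof.
case: a => // a _; rewrite /N0 /=.
case: ifP => _.
  by case: (ofnat n _) => // i; case: (ofnat n _) => // j; rewrite leq_b1.
by case: ifP => // _; case: (ofnat n _) => // i; rewrite leq_b1.
Qed.

Lemma init_adj (i j : 'I_n) : N0 (i * n + j + 1) = adj i j.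
Proof.
have lt_i := ltn_ord i; have lt_j := ltn_ord j; rewrite /N0 addn1 /=.
have -> : i * n + j < n * n by nia.
by rewrite subn1 /= divnMDl ?modnMDl ?divn_small ?modn_small ?addn0 /ofnat ?valK //; lia.
Qed.

Lemma init_Sstar (i : 'I_n) : N0 (n * n + 1 + i) = (i \in Sstar).
Proof.
have lt_i := ltn_ord i; rewrite /N0 addn1 addSn /=.
rewrite (_ : n * n + i < n * n = false) ?ltn_add2l ?lt_i; last by lia.
by rewrite subn1 /= addKn /ofnat valK.
Qed.

Lemma init_weight (i : 'I_n) : M0 i = w i.
Proof. by rewrite /M0 /= /ofnat valK. Qed.

Lemma init_weight_n : M0 n = 0%R.
Proof. by rewrite /M0 /= /ofnat insubF // ltnn. Qed.

Lemma init_acc : acc n N0 M0 n = mu w Sstar.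
Proof.
rewrite /acc /mu -{1}(subn0 n) -/(index_iota 0 n) big_mkord.
by apply: eq_big => [i | i _]; rewrite ?init_Sstar ?lt0b ?init_weight.
Qed.

Lemma init_edge (i j : 'I_n) : edge n N0 i j = induced adj (~: Sstar) i j.
Proof. by rewrite /edge init_adj !init_Sstar /induced !inE !eqb0 lt0b andbC andbA. Qed.

Definition conn_nat (x y : nat) : Prop :=
  exists i j : 'I_n, [/\ x = i, y = j & connect (induced adj (~: Sstar)) i j].

Hypothesis inst : is_instance adj w Sstar.

Context (lab : nat -> nat).
Hypothesis lab_conn : forall k, k < n -> lab k < n /\ conn_nat k (lab k).
Hypothesis lab_edge : forall x y, x < n -> y < n -> edge n N0 x y -> lab x = lab y.

(** Equal labels name one vertex connected to both [x] and [y]; conversely labels are constant along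
    the edges of a path. *)
Lemma lab_eq (x y : 'I_n) : (lab x == lab y) = connect (induced adj (~: Sstar)) x y.
Proof.
apply/eqP/idP => [lab_xy | /connectP[p]]; last first.
  elim: p x => [|z p IHp] x /=; first by move=> _ ->.
  by case/andP=> xz /IHp IH /IH <-; apply: lab_edge => //; rewrite init_edge.
have [_ [x1 [r [/val_inj <- lab_x xr]]]] := lab_conn (ltn_ord x).
have [_ [y1 [r' [/val_inj <- lab_y yr]]]] := lab_conn (ltn_ord y).
have rr : r = r' by apply: val_inj; rewrite /= -lab_x -lab_y.
by apply: connect_trans xr _; rewrite (connect_induced_sym inst) rr.
Qed.

Let heavy_nat h := (mu w Sstar < M0 h)%R.

Lemma has_heavy (x : 'I_n) :
  has (fun h => heavy_nat h && (lab h == lab x)) (iota 0 n) =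
  [exists h, heavy w Sstar h && connect (induced adj (~: Sstar)) x h].
Proof.
apply/hasP/existsP => [[h] | [h]].
  rewrite mem_iota /= add0n => lt_h hh; exists (Ordinal lt_h); move: hh.
  by rewrite -lab_eq eq_sym /heavy -init_weight.
rewrite -lab_eq eq_sym /heavy -init_weight => hh; exists (val h) => //.
by rewrite mem_iota /= add0n ltn_ord.
Qed.

Lemma out_label_same_part (x y : 'I_n) :
  (out_label lab heavy_nat n x == out_label lab heavy_nat n y) =
  same_part adj w Sstar x y.
Proof.
rewrite /out_label !has_heavy /same_part.
(* A component label could only clash with a singleton label [v]. But [lab u] is connected to [u],
   so [lab u = v] would connect [v] to a heavy vertex. *)
have mixed (u v : 'I_n) :
    [exists h, heavy w Sstar h && connect (induced adj (~: Sstar)) u h] ->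
    ~~ [exists h, heavy w Sstar h && connect (induced adj (~: Sstar)) v h] ->
    lab u != v.
  case/existsP=> h /andP[hh uh] /existsPn light; apply/eqP=> lab_u.
  have [_ [u1 [v1 [/val_inj <- lab_u' uv]]]] := lab_conn (ltn_ord u).
  have vv : v = v1 by apply: val_inj; rewrite /= -lab_u lab_u'.
  move: (light h); rewrite hh vv /= => /negP[]; apply: connect_trans uh.
  by rewrite (connect_induced_sym inst).
case: ifPn => hx; case: ifPn => hy.
- rewrite lab_eq andbT; case: eqP => // ->; exact: connect0.
- rewrite (negPf (mixed _ _ hx hy)); symmetry; apply/negbTE; rewrite negb_or andbT.
  apply/andP; split; first by apply: contraNneq hy => <-.
  apply: contra hy => xy; have /existsP[h /andP[hh xh]] := hx.
  apply/existsP; exists h; rewrite hh; apply: connect_trans xh.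
  by rewrite (connect_induced_sym inst).
- rewrite eq_sym (negPf (mixed _ _ hy hx)) andbF orbF; symmetry; apply/negbTE.
  by apply: contraNneq hx => ->.
- by rewrite andbF orbF.
Qed.

End InitialState.

(* Rank Minimization is solvable in polynomial time: a single RAM program
   that, on every instance with |V| = n, halts within c * (n+1)^k steps and
   outputs a valid partition of minimum rank. *)
Theorem theorem2p4 :
  exists (prog : seq instr) (c k : nat),
  forall (n : nat) (adj : rel 'I_n) (w : 'I_n -> R) (Sstar : {set 'I_n}),
    is_instance adj w Sstar ->
    exists s : state,
      exec prog (c * n.+1 ^ k) (init_state adj w Sstar) = Some s /\
      valid_partition adj Sstar (output_partition Sstar s) /\
      (forall Q : {set {set 'I_n}}, valid_partition adj Sstar Q ->
         (rank w Sstar (output_partition Sstar s) <= rank w Sstar Q)%N).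
Proof.
have [C [k costE]] := cost_poly rank_min.
(* The loop bound is taken as (n + 1)^2, at least n^2 + n + 1, which doubles the exponent. *)
exists (compile 0 rank_min), C, (2 * k) => n adj w Sstar inst.
pose N0 := nmem (init_state adj w Sstar); pose M0 := rmem (init_state adj w Sstar).
have le_b : n * n + n + 1 <= n.+1 ^ 2 by rewrite -mulnn; lia.
have conn_refl x : x < n -> conn_nat adj Sstar x x.
  by move=> lt_x; exists (Ordinal lt_x), (Ordinal lt_x); split; rewrite ?connect0.
have conn_sym x y : conn_nat adj Sstar x y -> conn_nat adj Sstar y x.
  case=> i [j [-> -> ij]]; exists j, i; split=> //.
  by rewrite (connect_induced_sym inst).
have conn_trans x y z :
    conn_nat adj Sstar x y -> conn_nat adj Sstar y z -> conn_nat adj Sstar x z.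
  case=> i [j [-> -> ij]] [j' [l [/val_inj <- -> jl]]]; exists i, l; split=> //.
  exact: connect_trans ij jl.
have conn_edge x y : x < n -> y < n -> edge n N0 x y -> conn_nat adj Sstar x y.
  move=> lt_x lt_y e_xy; exists (Ordinal lt_x), (Ordinal lt_y); split=> //.
  by apply: connect1; rewrite -(init_edge adj w Sstar).
have le_cost : cost (n.+1 ^ 2) rank_min <= C * n.+1 ^ (2 * k).
  by rewrite expnM; apply: costE; rewrite expn_gt0.
have ok_main := @rank_min_ok n N0 (n.+1 ^ 2) erefl (@init_bit n adj w Sstar) le_b
  _ _ _ _ _ erefl erefl erefl erefl erefl _ conn_refl conn_sym conn_trans conn_edge
  _ (init_weight_n adj w Sstar).
have [s [exec_s [lab [lab_conn lab_edge out_s]]]] := ok_exec ok_main le_cost.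
exists s; split=> //.
have fE : {in ~: Sstar &, forall x y : 'I_n,
    (nmem s x == nmem s y) = same_part adj w Sstar x y}.
  move=> x y _ _; rewrite !out_s // init_acc.
  exact: (out_label_same_part inst lab_conn lab_edge).
split; first exact: (valid_parts inst fE).
exact: (rank_le inst fE).
Qed.
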